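(* Affine policies give an $O\big(\frac{\log n}{\log\log n}\frac{\log L}{\log\log L}\big)$-approximation to the two-stage adjustable robust problem (AR): there exist absolute constants $C>0$ and $N$ such that for every instance of (AR) (defined in the context) with $n\ge N$ second-stage variables and a packing uncertainty set with $L\ge N$ constraints, the optimal value $z_{\mathrm{AFF}}$ over affine policies satisfies $$z_{\mathrm{AR}}\ \le\ z_{\mathrm{AFF}}\ \le\ C\cdot\frac{\log n}{\log\log n}\cdot\frac{\log L}{\log\log L}\cdot z_{\mathrm{AR}}.$$
   Context: Two-stage adjustable robust problem (AR): $$z_{\mathrm{AR}}=\min_{\mathbf x\in\mathcal X}\ \mathbf c^T\mathbf x+\max_{\mathbf h\in\mathcal U}\ \min_{\mathbf y\ge\mathbf 0}\{\mathbf d^T\mathbf y\mid\mathbf A\mathbf x+\mathbf B\mathbf y\ge\mathbf h\},$$ where $\mathbf A\in\mathbb R^{m\times n'}$, $\mathbf B\in\mathbb R_+^{m\times n}$, $\mathbf c\in\mathbb R_+^{n'}$, $\mathbf d\in\mathbb R_+^n$, $\mathcal X\subset\mathbb R_+^{n'}$ is a polyhedral cone, and the packing uncertainty set is $\mathcal U=\{\mathbf h\in\mathbb R^m\mid\mathbf h\ge\mathbf 0,\ \mathbf R\mathbf h\le\mathbf r\}$ with $\mathbf R\in\mathbb R_+^{L\times m}$, $\mathbf r\in\mathbb R_+^L$. It is assumed that for all $i\in[m]$ the quantities $\max\{z_i\mid\mathbf B^T\mathbf z\le\mathbf d,\mathbf z\ge\mathbf 0\}$ and $\max\{h_i\mid\mathbf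 h\in\mathcal U\}$ are finite. An affine policy consists of a first-stage solution $\mathbf x\in\mathcal X$ and a second-stage affine map $\mathbf y(\mathbf h)=\mathbf M\mathbf h+\mathbf q$ with $\mathbf M\in\mathbb R^{n\times m}$, $\mathbf q\in\mathbb R^n$. It is feasible if $\mathbf y(\mathbf h)\ge\mathbf 0$ and $\mathbf A\mathbf x+\mathbf B\mathbf y(\mathbf h)\ge\mathbf h$ for all $\mathbf h\in\mathcal U$. Its (worst-case) cost is $\mathbf c^T\mathbf x+\max_{\mathbf h\in\mathcal U}\mathbf d^T\mathbf y(\mathbf h)$. $z_{\mathrm{AFF}}$ is the minimum cost of a feasible affine policy. *)

(* Defs.v *)
From HB Require Import structures.
From mathcomp Require Import all_boot all_order all_algebra.
From mathcomp Require Import all_classical all_reals all_analysis.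

Set Implicit Arguments.
Unset Strict Implicit.
Unset Printing Implicit Defensive.

Import Order.TTheory GRing.Theory Num.Theory.

Local Open Scope classical_set_scope.
Local Open Scope ring_scope.

(* MathComp has no entrywise order on matrices; column vectors are the case
   of one column. *)
Definition mxle (R : realType) (p q : nat) (A B : 'M[R]_(p, q)) : Prop :=
  forall i j, A i j <= B i j.

Definition dot (R : realType) (k : nat) (u v : 'cV[R]_k) : R :=
  (u^T *m v) 0 0.

Definition polyhedral_cone (R : realType) (k : nat) (X : set 'cV[R]_k) : Prop :=
  exists (p : nat) (G : 'M[R]_(p, k)), X = [set x | mxle 0 (G *m x)].

Definition packing_set (R : realType) (m L : nat)
    (Q : 'M[R]_(L, m)) (r : 'cV[R]_L) : set 'cV[R]_m :=
  [set h | mxle 0 h /\ mxle (Q *m h) r].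

Definition dual_set (R : realType) (m n : nat)
    (B : 'M[R]_(m, n)) (d : 'cV[R]_n) : set 'cV[R]_m :=
  [set z | mxle (B^T *m z) d /\ mxle 0 z].

(* Optimal values are taken in the extended reals: a minimum is an infimum
   (+oo for an infeasible problem) and a maximum is a supremum. *)

Definition max_coord (R : realType) (m : nat) (S : set 'cV[R]_m) (i : 'I_m) :
    \bar R :=
  ereal_sup [set (z i 0)%:E | z in S].

Definition second_stage (R : realType) (m n n' : nat)
    (A : 'M[R]_(m, n')) (B : 'M[R]_(m, n)) (d : 'cV[R]_n)
    (x : 'cV[R]_n') (h : 'cV[R]_m) : \bar R :=
  ereal_inf [set (dot d y)%:E | y in
    [set y : 'cV[R]_n | mxle 0 y /\ mxle h (A *m x + B *m y)]].

Definition zAR (R : realType) (m n n' : nat)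
    (A : 'M[R]_(m, n')) (B : 'M[R]_(m, n)) (c : 'cV[R]_n') (d : 'cV[R]_n)
    (X : set 'cV[R]_n') (U : set 'cV[R]_m) : \bar R :=
  ereal_inf [set ((dot c x)%:E
                  + ereal_sup [set second_stage A B d x h | h in U])%E
            | x in X].

Record affine_policy (R : realType) (m n n' : nat) := AffinePolicy {
  policy_x : 'cV[R]_n';
  policy_M : 'M[R]_(n, m);
  policy_q : 'cV[R]_n
}.

Definition policy_y (R : realType) (m n n' : nat)
    (p : affine_policy R m n n') (h : 'cV[R]_m) : 'cV[R]_n :=
  policy_M p *m h + policy_q p.

Definition affine_feasible (R : realType) (m n n' : nat)
    (A : 'M[R]_(m, n')) (B : 'M[R]_(m, n))
    (X : set 'cV[R]_n') (U : set 'cV[R]_m)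
    (p : affine_policy R m n n') : Prop :=
  X (policy_x p) /\
  forall h, U h ->
    mxle 0 (policy_y p h) /\ mxle h (A *m policy_x p + B *m policy_y p h).

Definition affine_cost (R : realType) (m n n' : nat)
    (c : 'cV[R]_n') (d : 'cV[R]_n) (U : set 'cV[R]_m)
    (p : affine_policy R m n n') : \bar R :=
  ((dot c (policy_x p))%:E
   + ereal_sup [set (dot d (policy_y p h))%:E | h in U])%E.

Definition zAFF (R : realType) (m n n' : nat)
    (A : 'M[R]_(m, n')) (B : 'M[R]_(m, n)) (c : 'cV[R]_n') (d : 'cV[R]_n)
    (X : set 'cV[R]_n') (U : set 'cV[R]_m) : \bar R :=
  ereal_inf [set affine_cost c d U p | p in affine_feasible A B X U].

Definition log_ratio (R : realType) (k : nat) : R :=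
  ln (k%:R : R) / ln (ln (k%:R : R)).

(* Main.v *)
Require Import Defs.
From HB Require Import structures.
From mathcomp Require Import all_boot all_order all_algebra.
From mathcomp Require Import all_classical all_reals all_analysis.
From mathcomp Require Import ring lra.

Set Implicit Arguments.
Unset Strict Implicit.
Unset Printing Implicit Defensive.

Import Order.TTheory GRing.Theory Num.Theory.

Local Open Scope classical_set_scope.
Local Open Scope ring_scope.

(** Fix a first stage [x] whose worst second-stage cost is at most [s], let [th i] and [ga i]
    be the maxima of [z_i] over the dual set and of [h_i] over the uncertainty set, and let
    [z1], [z2] be [4 log k / log log k] for [k = L], [n].  Consider the linear program
    maximizing [sum_i th_i (ga_i - z1 (A x)_i)^+ w_i] over [0 <= w <= 1] subject to
    [sum_i Q_ki ga_i w_i <= r_k] and [sum_i B_ij th_i w_i <= d_j].  Rounding [w] to a random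
    set of rows overloads the packing constraints by at most [z1] and the dual constraints by
    at most [z2] (Chernoff), which gives a scenario and a dual vector whose pairing shows that
    the program has value at most [2 z1 z2 s].  A dual solution [(u, v, t)] of the program
    yields an affine policy with first stage [z1 x] and second stage
    [v + z1 y2 + sum_i (h_i (Q^T u)_i + t_i) / th_i * Y_i], where [Y_i] covers the [i]-th unit
    vector at cost [th_i] and [y2] covers [- A x] at cost [s]; its cost is at most
    [z1 c x + z1 s + 2 z1 z2 s]. *)

(** * Farkas' lemma and linear programming duality *)

(* Bartl's induction: if the functionals of [s] alone do not force [g <= 0], a witness [x0]
   of this spans a complement of the kernel of [a k], along which all functionals are projected. *)
Lemma farkas (R : realFieldType) (V : lmodType R) (K : eqType) (s : seq K)
    (a : K -> V -> R) (g : V -> R) :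
  uniq s -> (forall i, scalar (a i)) -> scalar g ->
  (forall x, (forall i, i \in s -> a i x <= 0) -> g x <= 0) ->
  exists l : K -> R, (forall i, 0 <= l i) /\
    forall x, g x = \sum_(i <- s) l i * a i x.
Proof.
elim: s a g => [|k s IHs] a g.
  move=> _ _ lg neg_g; exists (fun=> 0); split=> // x; rewrite big_nil.
  apply/eqP; rewrite eq_le neg_g //=.
  have g0 : g 0 = 0 by have := lg (-1) 0 0; rewrite scaler0 addr0; lra.
  have := lg (-1) x 0; rewrite addr0 g0 => gN.
  by have := neg_g (-1 *: x); rewrite gN => /(_ (fun _ _ => ltac:(by []))); lra.
rewrite cons_uniq => /andP[kNs us] la lg neg_g.
have [neg_gs|] := pselect (forall x, (forall i, i \in s -> a i x <= 0) -> g x <= 0).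
  have [l [l0 gE]] := IHs a g us la lg neg_gs.
  exists (fun i => if i == k then 0 else l i); split=> [i|x]; first by case: eqP.
  rewrite big_cons eqxx mul0r add0r gE; apply: eq_big_seq => i si.
  by case: eqP => // ik; rewrite -ik si in kNs.
move=> /existsNP[x0 /not_implyP[x0s /negP]]; rewrite -ltNge => gx0.
have akx0 : 0 < a k x0.
  rewrite ltNge; apply/negP => akx0; move: gx0; rewrite ltNge neg_g// => i.
  by rewrite inE => /predU1P[->|/x0s].
pose proj (f : V -> R) x : R := f x - a k x / a k x0 * f x0.
have lproj f : scalar f -> scalar (proj f).
  by move=> lf c x y; rewrite /proj lf (la k); lra.
have [||x negx|l [l0 gE]] := IHs (fun i => proj (a i)) (proj g) us.
- by move=> i; apply: lproj.
- exact: lproj.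
- have projE f : scalar f -> proj f x = f (- (a k x / a k x0) *: x0 + x).
    by move=> lf; rewrite lf /proj; lra.
  rewrite (projE g lg); apply: neg_g => i; rewrite inE => /predU1P[->|si].
    by rewrite la mulNr divfK ?gt_eqF// addNr.
  by rewrite -projE //; apply: negx.
(* This multiplier of [a k] makes the identity hold at [x0]; it is nonnegative because [g x0 > 0]
   while every [a j x0 <= 0] for [j] in [s]. *)
exists (fun i => if i == k then (g x0 - \sum_(j <- s) l j * a j x0) / a k x0 else l i).
split=> [i|x].
  case: eqP => // _; rewrite divr_ge0 ?(ltW akx0)// subr_ge0.
  apply: le_trans (ltW gx0); rewrite big_seq sumr_le0 // => j sj.
  by rewrite mulr_ge0_le0 // x0s.
rewrite big_cons eqxx; set c := (g x0 - _) / _.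
rewrite (@eq_big_seq _ _ _ _ _ _ (fun i => l i * a i x)); last first.
  by move=> i si; case: eqP => // ik; rewrite -ik si in kNs.
have := gE x; rewrite /proj /=; under eq_bigr do rewrite mulrBr mulrCA.
rewrite sumrB -mulr_sumr => gEx.
by rewrite -[g x](subrK (a k x / a k x0 * g x0)) gEx /c; ring.
Qed.

(** Farkas' lemma for the homogenized program, whose extra coordinate [None] scales [b] and [v]. The
    multipliers of the rows form [u]; those of the sign constraints are the slacks that turn
    equalities into inequalities. *)
Lemma lp_duality (R : realFieldType) (I J : finType) (M : J -> I -> R)
    (b : J -> R) (p : I -> R) (v : R) :
  (forall j, 0 <= b j) ->
  (forall w : I -> R, (forall i, 0 <= w i) ->
     (forall j, \sum_i M j i * w i <= b j) -> \sum_i p i * w i <= v) ->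
  exists u : J -> R, [/\ forall j, 0 <= u j,
    forall i, p i <= \sum_j M j i * u j & \sum_j b j * u j <= v].
Proof.
move=> b0 bound.
have v0 : 0 <= v.
  have := bound (fun=> 0); rewrite big1 => [|i _]; last by rewrite mulr0.
  by apply=> // j; rewrite big1 // => i _; rewrite mulr0.
pose V := {ffun option I -> R^o}.
pose a (k : J + option I) (x : V) : R :=
  match k with
  | inl j => \sum_i M j i * x (Some i) - b j * x None
  | inr o => - x o
  end.
pose g (x : V) : R := \sum_i p i * x (Some i) - v * x None.
have lsum (q : I -> R) (c : R) (x y : V) :
    \sum_i q i * (c *: x + y) (Some i) =
    c * \sum_i q i * x (Some i) + \sum_i q i * y (Some i).
  rewrite mulr_sumr -big_split; apply: eq_bigr => i _.
  by rewrite !ffunE /GRing.scale /=; ring.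
have la k : scalar (a k).
  case: k => [j|o] c x y; rewrite /a ?lsum !ffunE /GRing.scale /=; ring.
have lg : scalar g.
  by move=> c x y; rewrite /g lsum !ffunE /GRing.scale /=; ring.
have [|l [l0 gE]] := @farkas R V _ (index_enum (J + option I)%type) a g (index_enum_uniq _) la lg.
  move=> x xneg.
  have x0 o : 0 <= x o by have := xneg (inr o) (mem_index_enum _); rewrite /a oppr_le0.
  have xM j : \sum_i M j i * x (Some i) <= b j * x None.
    by have := xneg (inl j) (mem_index_enum _); rewrite /a subr_le0.
  rewrite /g subr_le0.
  have := x0 None; rewrite le_eqVlt => /predU1P[t0|t0]; last first.
    have := bound (fun i => x (Some i) / x None).
    under eq_bigr do rewrite mulrA; rewrite -mulr_suml ler_pdivrMr //; apply.
      by move=> i; rewrite divr_ge0.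
    by move=> j; under eq_bigr do rewrite mulrA; rewrite -mulr_suml ler_pdivrMr.
  (* [x] is a recession direction, along which a positive objective would be unbounded *)
  rewrite -t0 mulr0 leNgt; apply/negP; set P := \sum_i _ => P0.
  have := bound (fun i => (v + 1) / P * x (Some i)).
  under eq_bigr do rewrite mulrCA; rewrite -mulr_sumr divfK ?gt_eqF //.
  have c0 : 0 <= (v + 1) / P by rewrite divr_ge0 ?(ltW P0)// addr_ge0.
  have h1 i : 0 <= (v + 1) / P * x (Some i) by rewrite mulr_ge0.
  have h2 j : \sum_i M j i * ((v + 1) / P * x (Some i)) <= b j.
    under eq_bigr do rewrite mulrCA; rewrite -mulr_sumr.
    apply: le_trans (b0 j); rewrite mulr_ge0_le0 //.
    by have := xM j; rewrite -t0 mulr0.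
  by move=> /(_ h1 h2); lra.
pose e o : V := [ffun o' => (o == o')%:R].
have sume (q : I -> R) i : \sum_k q k * e (Some i) (Some k) = q i.
  rewrite (bigD1 i) //= ffunE eqxx mulr1 big1 ?addr0 // => k ki.
  by rewrite ffunE (inj_eq Some_inj) eq_sym (negbTE ki) mulr0.
have sumeN (q : I -> R) : \sum_k q k * e None (Some k) = 0.
  by rewrite big1 // => k _; rewrite ffunE mulr0.
have sumN o : \sum_k l (inr k) * - e o k = - l (inr o).
  rewrite (bigD1 o) //= ffunE eqxx mulrN mulr1 big1 ?addr0 // => k ko.
  by rewrite ffunE eq_sym (negbTE ko) oppr0 mulr0.
exists (fun j => l (inl j)); split=> // [i|].
- have := gE (e (Some i)); rewrite /g sume ffunE /= mulr0 subr0 big_sumType /= /a sumN => ->.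
  under eq_bigr do rewrite sume ffunE /= mulr0 subr0 mulrC.
  by rewrite gerDl oppr_le0.
- have := gE (e None); rewrite /g sumeN ffunE /= mulr1 big_sumType /= /a sumN.
  under eq_bigr do rewrite sumeN ffunE /= mulr1 sub0r mulrN mulrC.
  by rewrite sumrN => gN; have := l0 (inr None); lra.
Qed.

(** * Chernoff bounds and randomized rounding *)

Lemma expR_le_chord (R : realType) (t a : R) :
  0 <= a <= 1 -> expR (t * a) <= 1 + a * (expR t - 1).
Proof.
move=> a01.
have := @convex_expR R (Itv01 (andP a01).1 (andP a01).2) t 0.
rewrite !convRE /= expR0 mulr0 addr0 mulr1 => h.
rewrite mulrC; apply: le_trans h _; rewrite /unstable.onem; lra.
Qed.

(** When each [i] is included independently with probability [w i], this is an expected profit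
    weighted by a product over the random set: linearity splits the profit over [i], and
    independence factors each term. *)
Lemma expected_weight_prod (R : realType) (I : finType) (w p e : I -> R) :
  \sum_(S : {set I}) (\prod_i (if i \in S then w i else 1 - w i)) *
     ((\sum_(i in S) p i) * \prod_(i in S) e i) =
  \sum_i p i * (w i * e i * \prod_(k | k != i) (w k * e k + (1 - w k))).
Proof.
(* The value 0 at [i] annihilates every set that misses [i], so the sum can run over all sets and be
   distributed. *)
pose g i k : R := if k == i then 0 else 1 - w k.
transitivity (\sum_(S : {set I}) \sum_i
    p i * \prod_k (if k \in S then w k * e k else g i k)).
  apply: eq_bigr => S _.
  rewrite mulrCA mulr_suml [LHS]big_mkcond; apply: eq_bigr => i _.
  case: ifPn => iS; last by rewrite (bigD1 i) //= (negbTE iS) /g eqxx mul0r mulr0.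
  congr (_ * _); rewrite (big_mkcond (mem S)) -big_split /=.
  apply: eq_bigr => k _; rewrite /g; case: ifPn => kS //.
  by rewrite mulr1; case: eqP => // ki; rewrite ki iS in kS.
rewrite exchange_big; apply: eq_bigr => i _.
rewrite -mulr_sumr -bigA_distr (bigD1 i) //= /g eqxx addr0.
by congr (_ * (_ * _)); apply: eq_bigr => k /negbTE->.
Qed.

(** Chernoff's moment bound, weighted by the profit. The element [i] that earns [p i] is certainly
    in the set and contributes a factor at most [expR t]; by convexity each other [k] contributes at
    most [expR ((expR t - 1) * (a k * w k))], and the expected load is at most 1. *)
Lemma expected_weight_exp_load (R : realType) (I : finType) (w p a : I -> R) (t : R) :
  (forall i, 0 <= w i <= 1) -> (forall i, 0 <= p i) -> (forall i, 0 <= a i <= 1) ->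
  \sum_i a i * w i <= 1 -> 0 <= t ->
  \sum_(S : {set I}) (\prod_i (if i \in S then w i else 1 - w i)) *
     ((\sum_(i in S) p i) * expR (t * \sum_(i in S) a i)) <=
  expR (t + expR t - 1) * \sum_i p i * w i.
Proof.
move=> w01 p0 a01 aw t0.
have E1 : 0 <= expR t - 1 by rewrite subr_ge0 -expR0 ler_expR.
under eq_bigr do rewrite mulr_sumr expR_sum.
rewrite expected_weight_prod.
rewrite mulr_sumr; apply: ler_sum => i _.
rewrite [leRHS]mulrCA ler_wpM2l //.
have [w0 w1] := andP (w01 i); have [ai0 ai1] := andP (a01 i).
rewrite -addrA expRD [leRHS]mulrC mulrA; apply: ler_pM.
- by rewrite mulr_ge0 ?expR_ge0.
- apply: prodr_ge0 => k _; have [wk0 wk1] := andP (w01 k).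
  by rewrite addr_ge0 ?mulr_ge0 ?expR_ge0 // subr_ge0.
- by rewrite ler_wpM2l // ler_expR ler_piMr.
apply: (@le_trans _ _ (\prod_(k | k != i) expR ((expR t - 1) * (a k * w k)))).
  apply: ler_prod => k ki.
  have [wk0 wk1] := andP (w01 k); rewrite addr_ge0 ?mulr_ge0 ?expR_ge0 ?subr_ge0 //=.
  apply: le_trans (expR_ge1Dx _).
  have := ler_wpM2l wk0 (expR_le_chord t (a01 k)); lra.
rewrite -expR_sum ler_expR -mulr_sumr ler_piMr //; apply: le_trans aw.
rewrite [leRHS](bigD1 i) //= lerDr mulr_ge0 //.
Qed.

(* The profit of a random set is discounted by its exponential overloads, so that a set whose
   discounted profit is at least the expected one is both profitable and not overloaded. *)
Lemma randomized_rounding (R : realType) (I J : finType) (a : J -> I -> R)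
    (w p : I -> R) (t z : J -> R) :
  (forall i, 0 <= w i <= 1) -> (forall i, 0 <= p i) ->
  (forall j i, 0 <= a j i <= 1) -> (forall j, \sum_i a j i * w i <= 1) ->
  (forall j, 0 < t j) -> (forall j, 0 <= z j) ->
  \sum_j expR (t j + expR (t j) - 1 - t j * z j) <= 2^-1 ->
  exists S : {set I}, (forall j, \sum_(i in S) a j i <= z j) /\
    \sum_i p i * w i <= 2 * \sum_(i in S) p i.
Proof.
move=> w01 p0 a01 aw t0 z0 small.
pose P (S : {set I}) : R := \prod_i (if i \in S then w i else 1 - w i).
pose V (S : {set I}) : R := \sum_(i in S) p i.
pose G S : R := V S * (1 - \sum_j expR (t j * (\sum_(i in S) a j i) - t j * z j)).
pose E : R := \sum_i p i * w i.
have P0 S : 0 <= P S.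
  apply: prodr_ge0 => i _; have [? ?] := andP (w01 i).
  by case: ifP; rewrite ?subr_ge0.
have P1 : \sum_S P S = 1.
  by rewrite -bigA_distr big1 // => i _; rewrite /= addrC subrK.
have E0 : 0 <= E by apply: sumr_ge0 => i _; rewrite mulr_ge0 //; case/andP: (w01 i).
have V0 S : 0 <= V S by apply: sumr_ge0.
move: E0; rewrite le_eqVlt => /predU1P[E0|Egt0].
  exists finset.set0; split; first by move=> j; rewrite big_set0.
  by rewrite big_set0 mulr0 -[X in X <= _]E0.
have EV : \sum_S P S * V S = E.
  have := expected_weight_prod w p (fun=> 1).
  under eq_bigr do rewrite big1_eq mulr1.
  move=> ->; apply: eq_bigr => i _; rewrite big1 ?mulr1 // => k _; lra.
(* In expectation each constraint discounts at most its share of [E], and by [small] the shares add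
   up to at most one half. *)
have EG : 2^-1 * E <= \sum_S P S * G S.
  have -> : \sum_S P S * G S = E - \sum_j expR (- (t j * z j)) *
      \sum_S P S * (V S * expR (t j * \sum_(i in S) a j i)).
    rewrite -EV; under [X in _ = _ - X]eq_bigr do rewrite mulr_sumr.
    rewrite exchange_big -sumrB; apply: eq_bigr => S _.
    rewrite /G mulrBr mulr1 mulrBr; congr (_ - _).
    rewrite !mulr_sumr; apply: eq_bigr => j _; rewrite expRD; ring.
  rewrite lerBrDr -lerBrDl.
  apply: (@le_trans _ _ (\sum_j expR (t j + expR (t j) - 1 - t j * z j) * E)).
    apply: ler_sum => j _; rewrite addrC expRD -mulrA ler_wpM2l ?expR_ge0 //.
    by apply: expected_weight_exp_load => //; rewrite ltW.
  rewrite -mulr_suml; have := ler_wpM2r (ltW Egt0) small; lra.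
have [S GS] : exists S, 2^-1 * E <= G S.
  apply: contrapT => /forallNP noS.
  have : \sum_S P S * G S < \sum_S P S * (2^-1 * E).
    have le S : P S * G S <= P S * (2^-1 * E).
      by rewrite ler_wpM2l // ltW // ltNge; apply/negP/noS.
    have [S PS] : exists S, 0 < P S.
      apply: contrapT => /forallNP P00.
      have : \sum_S P S = 0.
        by apply: big1 => S _; apply/eqP; rewrite eq_le P0 andbT leNgt; apply/negP/P00.
      by rewrite P1 => /eqP; rewrite oner_eq0.
    rewrite (bigD1 S) //= [ltRHS](bigD1 S) //= ltr_leD ?ler_sum //.
    by rewrite ltr_pM2l // ltNge; apply/negP/noS.
  by rewrite -mulr_suml P1 mul1r ltNge EG.
have G0 : 0 < G S by apply: lt_le_trans GS; rewrite mulr_gt0 // invr_gt0.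
have D0 : 0 < 1 - \sum_j expR (t j * (\sum_(i in S) a j i) - t j * z j).
  by rewrite ltNge; apply/negP => D0; move: G0; rewrite ltNge /G mulr_ge0_le0.
exists S; split=> [j|].
  (* An overloaded constraint alone would give a discount of at least [expR 0], that is 1, against
     [D0]. *)
  rewrite leNgt; apply/negP => zj; move: D0; rewrite ltNge subr_le0 => /negP; apply.
  rewrite (bigD1 j) //= -[leLHS]addr0 lerD //; last by apply: sumr_ge0 => k _; exact: expR_ge0.
  by rewrite -expR0 ler_expR -mulrBr mulr_ge0 ?subr_ge0 ?(ltW zj) // ltW.
have GV : G S <= V S.
  by rewrite /G ler_piMr // gerBl sumr_ge0 // => j _; exact: expR_ge0.
by move: (le_trans GS GV); rewrite /E /V; lra.
Qed.

(** * Estimates for the overload factors *)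

(** The inequality ln (1 + x) <= x at x = -1/2 gives ln 2 >= 1/2, hence ln 16 >= 2. The threshold 16
    thus makes [ln (ln k)] positive. *)
Lemma ln_gt1 (R : realType) (k : nat) : (16 <= k)%N -> 1 < ln (k%:R : R).
Proof.
move=> k16.
have k0 : 0 < k%:R :> R by rewrite ltr0n (leq_trans _ k16).
apply: (@lt_le_trans _ _ (ln 16)); last by rewrite ler_ln ?posrE // ler_nat.
have -> : 16 = 2 ^+ 4 :> R by ring.
rewrite lnXn //.
have : ln (2^-1 : R) <= - 2^-1.
  by have := @le_ln1Dx R (- 2^-1); rewrite (_ : 1 - 2^-1 = 2^-1) => [|]; [apply|]; lra.
rewrite lnV ?posrE // => h; lra.
Qed.

Lemma log_ratio_ge1 (R : realType) (k : nat) : (16 <= k)%N -> 1 <= log_ratio R k.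
Proof.
move=> /(ln_gt1 R) ln1; rewrite /log_ratio ler_pdivlMr ?ln_gt0 // mul1r.
by rewrite ltW // ln_sublinear // (lt_trans _ ln1).
Qed.

(* With [t = ln (ln k)], hence [expR t = ln k], the exponent is at most [- ln (4 k)]. *)
Lemma sum_overload_le (R : realType) (k : nat) (t := ln (ln (k%:R : R))) :
  (16 <= k)%N ->
  \sum_(j < k) expR (t + expR t - 1 - t * (4 * log_ratio R k)) <= 4^-1.
Proof.
move=> k16; have ln1 := ln_gt1 R k16.
have k0 : 0 < k%:R :> R by rewrite ltr0n (leq_trans _ k16).
have l0 : 0 < ln (k%:R : R) by rewrite (lt_trans _ ln1).
have t0 : 0 < t by rewrite ln_gt0.
rewrite sumr_const card_ord -[leLHS]mulr_natl -ler_pdivlMl //.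
have -> : (k%:R)^-1 * 4^-1 = expR (- ln k%:R - ln 4) :> R.
  by rewrite expRD !expRN !lnK ?posrE.
rewrite ler_expR lnK ?posrE //.
have -> : t * (4 * log_ratio R k) = 4 * ln k%:R.
  by rewrite /log_ratio -/t mulrC -mulrA divfK ?gt_eqF.
have : ln (4 : R) <= ln k%:R by rewrite ler_ln ?posrE // ler_nat (leq_trans _ k16).
have := ln_sublinear l0; rewrite -/t; lra.
Qed.

(** * Packing sets and duality of the second stage *)

Lemma dotE (R : realType) (k : nat) (u v : 'cV[R]_k) :
  dot u v = \sum_i u i 0 * v i 0.
Proof. by rewrite /dot mxE; apply: eq_bigr => i _; rewrite mxE. Qed.

Lemma dotD (R : realType) (k : nat) (u v w : 'cV[R]_k) :
  dot u (v + w) = dot u v + dot u w.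
Proof. by rewrite /dot mulmxDr mxE. Qed.

Lemma dotZ (R : realType) (k : nat) (a : R) (u v : 'cV[R]_k) :
  dot u (a *: v) = a * dot u v.
Proof. by rewrite /dot -scalemxAr mxE. Qed.

Lemma dot_sum (R : realType) (k : nat) (I : finType) (u : 'cV[R]_k) (F : I -> 'cV[R]_k) :
  dot u (\sum_i F i) = \sum_i dot u (F i).
Proof. by rewrite /dot mulmx_sumr summxE. Qed.

Lemma dot_ge0 (R : realType) (k : nat) (u v : 'cV[R]_k) :
  mxle 0 u -> mxle 0 v -> 0 <= dot u v.
Proof.
move=> u0 v0; rewrite dotE; apply: sumr_ge0 => i _.
by move: (u0 i 0) (v0 i 0); rewrite !mxE => *; rewrite mulr_ge0.
Qed.

Lemma mulmx_ge0 (R : realType) (k l : nat) (B : 'M[R]_(k, l)) (v : 'cV[R]_l) :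
  mxle 0 B -> mxle 0 v -> mxle 0 (B *m v).
Proof.
move=> B0 v0 i j; rewrite !mxE; apply: sumr_ge0 => t _.
by move: (B0 i t) (v0 t j); rewrite !mxE => *; rewrite mulr_ge0.
Qed.

Lemma dual_set_packing (R : realType) (m n : nat) (B : 'M[R]_(m, n)) (d : 'cV[R]_n) :
  dual_set B d = packing_set B^T d.
Proof. by apply/seteqP; split=> z [? ?]; split. Qed.

Lemma packing_set0 (R : realType) (m L : nat) (Q : 'M[R]_(L, m)) (r : 'cV[R]_L) :
  mxle 0 r -> packing_set Q r 0.
Proof. by move=> r0; split=> [i j|]; rewrite ?mulmx0. Qed.

(** By nonnegativity each point of the set satisfies [Q k i * h i 0 <= r k 0] in every single
    coordinate, and this passes to the supremum. The last clause bounds the normalized sizes by 1 in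
    the rounding. *)
Lemma max_coord_packing (R : realType) (m L : nat) (Q : 'M[R]_(L, m)) (r : 'cV[R]_L) :
  mxle 0 Q -> mxle 0 r ->
  (forall i, max_coord (packing_set Q r) i \is a fin_num) ->
  exists t : 'I_m -> R, [/\ forall i, 0 <= t i,
    forall h i, packing_set Q r h -> h i 0 <= t i &
    forall k i, Q k i * t i <= r k 0].
Proof.
move=> Q0 r0 tfin; pose t i := fine (max_coord (packing_set Q r) i).
have tE i : max_coord (packing_set Q r) i = (t i)%:E by rewrite fineK.
have tub h i : packing_set Q r h -> h i 0 <= t i.
  by move=> Uh; rewrite -lee_fin -tE; apply: ereal_sup_ubound; exists h.
exists t; split=> // [i|k i].
  by have := tub 0 i (packing_set0 Q r0); rewrite mxE.
have := Q0 k i; rewrite mxE le_eqVlt => /predU1P[<-|Qki].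
  by rewrite mul0r; have := r0 k 0; rewrite mxE.
rewrite mulrC -ler_pdivlMr // -lee_fin -tE.
apply: ge_ereal_sup => _ [h [h0 Qh] <-]; rewrite lee_fin ler_pdivlMr // mulrC.
apply: le_trans (Qh k 0); rewrite mxE (bigD1 i) //= lerDl; apply: sumr_ge0 => j _.
by move: (Q0 k j) (h0 j 0); rewrite !mxE => *; rewrite mulr_ge0.
Qed.

(** Weak duality: z^T (h - A x) <= z^T B y <= d^T y. *)
Lemma second_stage_ge (R : realType) (m n n' : nat) (A : 'M[R]_(m, n')) (B : 'M[R]_(m, n))
    (d : 'cV[R]_n) (x : 'cV[R]_n') (h z : 'cV[R]_m) :
  dual_set B d z ->
  ((\sum_i z i 0 * (h i 0 - (A *m x) i 0))%:E <= second_stage A B d x h)%E.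
Proof.
move=> [zB z0]; apply: le_ereal_inf_tmp => _ [y [y0 hy] <-]; rewrite lee_fin.
apply: (@le_trans _ _ (dot z (B *m y))).
  rewrite dotE; apply: ler_sum => i _; rewrite ler_wpM2l //.
    by have := z0 i 0; rewrite mxE.
  by have := hy i 0; rewrite [X in _ <= X]mxE; lra.
have -> : dot z (B *m y) = dot (B^T *m z) y by rewrite /dot trmx_mul trmxK mulmxA.
rewrite !dotE; apply: ler_sum => j _; rewrite ler_wpM2r //.
by have := y0 j 0; rewrite mxE.
Qed.

(** Strong duality for covering [g]: the dual solution [u] is the cover. *)
Lemma cover_of_dual_bound (R : realType) (m n : nat) (B : 'M[R]_(m, n)) (d : 'cV[R]_n)
    (g : 'I_m -> R) (v : R) :
  mxle 0 d -> (forall z, dual_set B d z -> \sum_i g i * z i 0 <= v) ->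
  exists y : 'cV[R]_n, [/\ mxle 0 y, forall i, g i <= (B *m y) i 0 & dot d y <= v].
Proof.
move=> d0 bound.
have [||u [u0 gu du]] := @lp_duality R _ _ (fun j i => B i j) (fun j => d j 0) g v.
- by move=> j; have := d0 j 0; rewrite mxE.
- move=> w w0 wB; have := bound (\col_i w i).
  under eq_bigr do rewrite mxE; apply; split=> [j k|i k]; rewrite !mxE //.
  rewrite ord1; apply: le_trans (wB j).
  by apply: ler_sum => i _; rewrite !mxE.
exists (\col_j u j); split=> [j k|i|]; first by rewrite !mxE.
- by rewrite mxE; under eq_bigr do rewrite mxE.
- by rewrite dotE; under eq_bigr do rewrite mxE.
Qed.

Lemma polyhedral_coneZ (R : realType) (k : nat) (X : set 'cV[R]_k) (a : R) (x : 'cV[R]_k) :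
  polyhedral_cone X -> 0 <= a -> X x -> X (a *: x).
Proof.
move=> [p [G ->]] a0 Gx i j; rewrite -scalemxAr [leRHS]mxE.
by have := Gx i j; rewrite !mxE => ?; rewrite mulr_ge0.
Qed.

(** * Value of the linear program *)

Lemma divr_in01 (R : realFieldType) (a b : R) : 0 <= a -> a <= b -> 0 <= a / b <= 1.
Proof.
move=> a0 ab; have b0 := le_trans a0 ab; rewrite divr_ge0 //=.
move: b0; rewrite le_eqVlt => /predU1P[<-|b0]; first by rewrite invr0 mulr0.
by rewrite ler_pdivrMr // mul1r.
Qed.

(* The rounded set of rows supports both a scenario [h] and a dual vector [z], whose pairing
   recovers the profit up to the two overload factors. *)
Lemma lp_value_le (R : realType) (m n L : nat) (B : 'M[R]_(m, n)) (d : 'cV[R]_n)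
    (Q : 'M[R]_(L, m)) (r : 'cV[R]_L) (th ga g : 'I_m -> R) (s : R)
    (z1 := 4 * log_ratio R L) (z2 := 4 * log_ratio R n) :
  (16 <= n)%N -> (16 <= L)%N -> mxle 0 B -> mxle 0 d -> mxle 0 Q -> mxle 0 r ->
  (forall i, 0 <= th i) -> (forall i, 0 <= ga i) ->
  (forall j i, B i j * th i <= d j 0) -> (forall k i, Q k i * ga i <= r k 0) ->
  (forall z h, dual_set B d z -> packing_set Q r h ->
     \sum_i z i 0 * (h i 0 - g i) <= s) ->
  forall w : 'I_m -> R, (forall i, 0 <= w i <= 1) ->
  (forall k, \sum_i (Q k i * ga i) * w i <= r k 0) ->
  (forall j, \sum_i (B i j * th i) * w i <= d j 0) ->
  \sum_i Num.max 0 (th i * (ga i - z1 * g i)) * w i <= 2 * (z1 * z2 * s).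
Proof.
move=> n16 L16 B0 d0 Q0 r0 th0 ga0 Bth Qga bound w w01 wQ wB.
have lr0 k : (16 <= k)%N -> 0 < 4 * log_ratio R k.
  by move=> /(log_ratio_ge1 R) lr1; lra.
have z10 : 0 < z1 by exact: lr0.
have z20 : 0 < z2 by exact: lr0.
pose p i : R := Num.max 0 (th i * (ga i - z1 * g i)).
(* Packing constraints ([inl]) and dual constraints ([inr]) are rounded together, so that one set of
   rows serves both; each family uses 1/4 of the allowed 1/2. *)
pose size (j : 'I_L + 'I_n) i :=
  match j with inl k => Q k i * ga i | inr j => B i j * th i end.
pose cap (j : 'I_L + 'I_n) := match j with inl k => r k 0 | inr j => d j 0 end.
pose t (j : 'I_L + 'I_n) : R :=
  match j with inl _ => ln (ln L%:R) | inr _ => ln (ln n%:R) end.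
pose zeta (j : 'I_L + 'I_n) : R := match j with inl _ => z1 | inr _ => z2 end.
have size0 j i : 0 <= size j i.
  case: j => k; rewrite mulr_ge0 //; first by have := Q0 k i; rewrite mxE.
  by have := B0 i k; rewrite mxE.
have size_cap j i : size j i <= cap j by case: j => k; [exact: Qga|exact: Bth].
(* A zero capacity forces a zero size, so the identity survives division by zero. *)
have sizeE j i : size j i = cap j * (size j i / cap j).
  have [c0|c0] := eqVneq (cap j) 0; last by rewrite mulrCA divff // mulr1.
  by have := size_cap j i; have := size0 j i; rewrite c0 mul0r; lra.
have [|||||||S [Sload Sp]] :=
    @randomized_rounding R _ _ (fun j i => size j i / cap j) w p t zeta.
- exact: w01.
- by move=> i; rewrite le_max lexx.
- by move=> j i; apply: divr_in01.
- move=> j; under eq_bigr do rewrite mulrAC; rewrite -mulr_suml.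
  have s0 : 0 <= \sum_i size j i * w i.
    by apply: sumr_ge0 => i _; rewrite mulr_ge0 //; case/andP: (w01 i).
  have sc : \sum_i size j i * w i <= cap j by case: (j) => k; [exact: wQ|exact: wB].
  by case/andP: (divr_in01 s0 sc).
- by case=> k; rewrite ln_gt0 // ln_gt1.
- by case=> k; exact: ltW.
- rewrite big_sumType /=.
  by have := sum_overload_le R L16; have := sum_overload_le R n16; rewrite -/z1 -/z2; lra.
(* Rows with [ga i < z1 * g i] earn no profit and could only lower the pairing, so they are
   dropped. *)
pose T := [set i in S | 0 <= ga i - z1 * g i].
have load j (f : 'I_m -> R) : (forall i, f i = if i \in T then size j i / zeta j else 0) ->
    \sum_i f i <= cap j.
  move=> fE; have zj : 0 < zeta j by case: (j).
  rewrite (eq_bigr _ (fun i _ => fE i)) -big_mkcond -mulr_suml ler_pdivrMr //.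
  have c0 : 0 <= cap j by case: (j) => k; [have := r0 k 0 | have := d0 k 0]; rewrite mxE.
  apply: (@le_trans _ _ (\sum_(i in S) size j i)).
    rewrite big_mkcond [leRHS]big_mkcond; apply: ler_sum => i _.
    by rewrite inE; case: (i \in S) => //=; case: ifP.
  by under eq_bigr do rewrite sizeE; rewrite -mulr_sumr ler_wpM2l //; exact: Sload.
pose h : 'cV[R]_m := \col_i (if i \in T then ga i / z1 else 0).
pose z : 'cV[R]_m := \col_i (if i \in T then th i / z2 else 0).
have Uh : packing_set Q r h.
  split=> [i k|k l]; first by rewrite !mxE; case: ifP => // _; rewrite divr_ge0 // ltW.
  rewrite ord1 mxE; apply: (load (inl k)) => i; rewrite mxE /=.
  by case: ifP; rewrite ?mulr0 // mulrA.
have Zz : dual_set B d z.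
  split=> [j l|i k]; last by rewrite !mxE; case: ifP => // _; rewrite divr_ge0 // ltW.
  rewrite ord1 mxE; apply: (load (inr j)) => i; rewrite !mxE /=.
  by case: ifP; rewrite ?mulr0 // mulrA.
apply: le_trans Sp _; rewrite ler_pM2l // -ler_pdivrMl //; last exact: mulr_gt0.
apply: le_trans (bound z h Zz Uh).
rewrite mulr_sumr big_mkcond; apply: ler_sum => i _; rewrite !mxE inE.
have [iS|] := boolP (i \in S); last by rewrite mul0r.
rewrite /=; case: ifPn => gi.
  rewrite /p max_r; last by rewrite mulr_ge0.
  by rewrite le_eqVlt; apply/orP; left; apply/eqP; field; rewrite !gt_eqF.
by rewrite mul0r /p max_l ?mulr0 // mulr_ge0_le0 // ltW // ltNge.
Qed.

(** * Construction of the affine policy *)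

Lemma affine_policy_of_bound (R : realType) (m n n' L : nat)
    (A : 'M[R]_(m, n')) (B : 'M[R]_(m, n)) (c : 'cV[R]_n') (d : 'cV[R]_n)
    (X : set 'cV[R]_n') (Q : 'M[R]_(L, m)) (r : 'cV[R]_L) (x : 'cV[R]_n') (s : R) :
  (16 <= n)%N -> (16 <= L)%N ->
  mxle 0 B -> mxle 0 c -> mxle 0 d -> polyhedral_cone X -> X `<=` [set x | mxle 0 x] ->
  mxle 0 Q -> mxle 0 r ->
  (forall i : 'I_m, max_coord (dual_set B d) i \is a fin_num) ->
  (forall i : 'I_m, max_coord (packing_set Q r) i \is a fin_num) ->
  X x -> 0 <= s -> (forall h, packing_set Q r h -> second_stage A B d x h <= s%:E)%E ->
  exists p : affine_policy R m n n', affine_feasible A B X (packing_set Q r) p /\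
    forall h, packing_set Q r h -> dot c (policy_x p) + dot d (policy_y p h) <=
      48 * log_ratio R n * log_ratio R L * (dot c x + s).
Proof.
move=> n16 L16 B0 c0 d0 coneX X0 Q0 r0 thfin gafin Xx s0 xs.
pose z1 := 4 * log_ratio R L; pose z2 := 4 * log_ratio R n.
have z11 : 1 <= z1 by have := log_ratio_ge1 R L16; rewrite /z1; lra.
have z21 : 1 <= z2 by have := log_ratio_ge1 R n16; rewrite /z2; lra.
have z10 : 0 <= z1 by exact: le_trans z11.
pose g i := (A *m x) i 0.
have bound z h : dual_set B d z -> packing_set Q r h ->
    \sum_i z i 0 * (h i 0 - g i) <= s.
  move=> Zz Uh; rewrite -lee_fin; apply: le_trans (xs h Uh); exact: second_stage_ge.
have BT0 : mxle 0 B^T by move=> j i; have := B0 i j; rewrite !mxE.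
have [th [th0 thub thB]] : exists th : 'I_m -> R, [/\ forall i, 0 <= th i,
    forall z i, dual_set B d z -> z i 0 <= th i & forall j i, B i j * th i <= d j 0].
  move: thfin; rewrite dual_set_packing => /(max_coord_packing BT0 d0)[th [? ? H]].
  by exists th; split=> // j i; have := H j i; rewrite mxE.
have [ga [ga0 gaub gaQ]] := max_coord_packing Q0 r0 gafin.
have /choice[Y YP] : forall i, exists y : 'cV[R]_n,
    [/\ mxle 0 y, forall k, (k == i)%:R <= (B *m y) k 0 & dot d y <= th i].
  move=> i; apply: cover_of_dual_bound => // z Zz.
  rewrite (bigD1 i) //= eqxx mul1r big1 ?addr0 ?thub // => k /negbTE->.
  by rewrite mul0r.
(* The cost bound in scenario 0 yields this cover, which offsets the rows where scaling [x] by [z1]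
   enlarges a deficit. *)
have [y2 [y20 y2A y2d]] : exists y : 'cV[R]_n,
    [/\ mxle 0 y, forall i, - g i <= (B *m y) i 0 & dot d y <= s].
  apply: cover_of_dual_bound => // z Zz.
  apply: le_trans (bound z 0 Zz (packing_set0 Q r0)); apply: ler_sum => i _.
  by rewrite mxE; lra.
(* The blocks are the packing, dual and upper bound constraints; their multipliers are named [u],
   [v] and [w] below. *)
pose M (j : 'I_L + ('I_n + 'I_m)) i : R :=
  match j with
  | inl k => Q k i * ga i
  | inr (inl j) => B i j * th i
  | inr (inr k) => (k == i)%:R
  end.
pose b (j : 'I_L + ('I_n + 'I_m)) : R :=
  match j with inl k => r k 0 | inr (inl j) => d j 0 | inr (inr _) => 1 end.
have [||uvw [uvw0 uvwP uvwV]] := @lp_duality R _ _ M b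
    (fun i => Num.max 0 (th i * (ga i - z1 * g i))) (2 * (z1 * z2 * s)).
- by case=> [k|[j|i]] /=; [have := r0 k 0|have := d0 j 0|]; rewrite ?mxE.
- move=> w w0 wM.
  apply: (@lp_value_le R m n L B d Q r th ga g s) => //.
  + move=> i; rewrite w0 /=; have := wM (inr (inr i)); rewrite /M /b /=.
    rewrite (bigD1 i) //= eqxx mul1r big1 ?addr0 // => k; rewrite eq_sym => /negbTE->.
    by rewrite mul0r.
  + by move=> k; exact: (wM (inl k)).
  + by move=> j; exact: (wM (inr (inl j))).
pose u : 'cV[R]_L := \col_k uvw (inl k).
pose v : 'cV[R]_n := \col_j uvw (inr (inl j)).
pose w i := uvw (inr (inr i)).
have v0 : mxle 0 v by move=> j k; rewrite !mxE.
have dualV : dot r u + (dot d v + \sum_i w i) <= 2 * (z1 * z2 * s).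
  apply: le_trans uvwV; rewrite !big_sumType /= !dotE.
  apply: lerD; first by apply: ler_sum => k _; rewrite mxE.
  apply: lerD; first by apply: ler_sum => k _; rewrite mxE.
  by apply: ler_sum => k _; rewrite mul1r.
have dualP i : th i * (ga i - z1 * g i) <=
    ga i * (Q^T *m u) i 0 + th i * (B *m v) i 0 + w i.
  have := uvwP i; rewrite !big_sumType /= ge_max => /andP[_].
  move=> /le_trans; apply; rewrite addrA !mxE !mulr_sumr; apply: lerD.
    by apply: lerD; apply: ler_sum => k _; rewrite !mxE; lra.
  rewrite (bigD1 i) //= eqxx mul1r big1 ?addr0 // => k /negbTE->; exact: mul0r.
have Qu0 i : 0 <= (Q^T *m u) i 0.
  rewrite mxE; apply: sumr_ge0 => k _; rewrite !mxE mulr_ge0 //.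
  by have := Q0 k i; rewrite mxE.
(* If [th i = 0], the dual constraint gives no cover of row [i]; but [Y i] then costs nothing, so
   coefficient 1 covers all of [h i 0] for free. *)
pose ka i := if th i == 0 then 1 else (Q^T *m u) i 0 / th i.
pose ta i := w i / th i.
have ka0 i : 0 <= ka i by rewrite /ka; case: ifP => // _; rewrite divr_ge0.
have ta0 i : 0 <= ta i by rewrite divr_ge0 // /w.
have kath i : ka i * th i <= (Q^T *m u) i 0.
  by rewrite /ka; case: eqVneq => [->|thi]; rewrite ?mulr0 // divfK.
have tath i : ta i * th i <= w i.
  rewrite /ta; have [->|thi] := eqVneq (th i) 0; first by rewrite mulr0 /w.
  by rewrite divfK.
pose p := AffinePolicy (z1 *: x) (\matrix_(j, i) (ka i * Y i j 0))
  (v + z1 *: y2 + \sum_i ta i *: Y i).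
have pE h : policy_y p h = v + z1 *: y2 + \sum_i (ka i * h i 0 + ta i) *: Y i.
  rewrite /policy_y /= addrC -addrA; congr (_ + _); apply/matrixP => j k.
  rewrite ord1 !mxE !summxE -big_split; apply: eq_bigr => i _.
  by rewrite !mxE /=; ring.
exists p; split.
  split; first exact: polyhedral_coneZ.
  move=> h Uh; have h0 i : 0 <= h i 0 by have := Uh.1 i 0; rewrite mxE.
  have co0 i : 0 <= ka i * h i 0 + ta i by rewrite addr_ge0 // mulr_ge0.
  rewrite pE; split=> [j k|i k]; rewrite ord1.
    have := v0 j 0; have := y20 j 0; rewrite !mxE summxE => y2j vj.
    apply: addr_ge0; first by rewrite addr_ge0 // mulr_ge0.
    apply: sumr_ge0 => i _; rewrite mxE mulr_ge0 //.
    by have [/(_ j 0)] := YP i; rewrite mxE.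
  have BYi : ka i * h i 0 + ta i <= (B *m (\sum_i (ka i * h i 0 + ta i) *: Y i)) i 0.
    rewrite mulmx_sumr summxE (bigD1 i) //=.
    rewrite -[leLHS]addr0 lerD //.
      rewrite -scalemxAr mxE ler_peMr //.
      by have [_ /(_ i)] := YP i; rewrite eqxx.
    apply: sumr_ge0 => l _; rewrite -scalemxAr mxE mulr_ge0 //.
    by have [_ /(_ i) + _] := YP l; apply: le_trans; rewrite ler0n.
  have y2i := ler_wpM2l z10 (y2A i).
  have vi : 0 <= (B *m v) i 0 by have := mulmx_ge0 B0 v0 i 0; rewrite mxE.
  have By2i : 0 <= z1 * (B *m y2) i 0.
    by rewrite mulr_ge0 //; have := mulmx_ge0 B0 y20 i 0; rewrite mxE.
  have addE (S T : 'cV[R]_m) : (S + T) i 0 = S i 0 + T i 0 by rewrite mxE.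
  have scaleE a (S : 'cV[R]_m) : (a *: S) i 0 = a * S i 0 by rewrite mxE.
  rewrite !mulmxDr -!scalemxAr !addE !scaleE -/(g i).
  suff : h i 0 * (1 - ka i) <= z1 * g i + (B *m v) i 0 + z1 * (B *m y2) i 0 + ta i by lra.
  have [ka1|ka1] := leP 1 (ka i).
    apply: (@le_trans _ _ 0); first by rewrite mulr_ge0_le0 // subr_le0.
    by have := ta0 i; lra.
  (* For [ka i < 1] the residual demand is largest at [ga i], where, multiplied by [th i], it is
     bounded by [dualP i]. *)
  apply: (@le_trans _ _ (ga i * (1 - ka i))).
    by rewrite ler_wpM2r ?gaub // subr_ge0 ltW.
  have thi : th i != 0 by apply: contraTneq ka1 => thi; rewrite /ka thi eqxx ltxx.
  have thi0 : 0 < th i by rewrite lt_neqAle eq_sym thi th0.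
  have kaE : ka i = (Q^T *m u) i 0 / th i by rewrite /ka (negbTE thi).
  rewrite -(ler_pM2l thi0).
  have kE : th i * ka i = (Q^T *m u) i 0 by rewrite kaE mulrC divfK.
  have tE : th i * ta i = w i by rewrite mulrC divfK.
  have := dualP i; have := mulr_ge0 (th0 i) By2i; rewrite -kE -tE; lra.
move=> h Uh; have h0 i : 0 <= h i 0 by have := Uh.1 i 0; rewrite mxE.
rewrite pE /= dotZ !dotD dotZ dot_sum.
(* The price (Q^T u)_i pays for [ka i * th i], and u^T Q h <= r^T u on the uncertainty set. *)
have costY : \sum_i dot d ((ka i * h i 0 + ta i) *: Y i) <= dot r u + \sum_i w i.
  apply: (@le_trans _ _ (\sum_i ((Q^T *m u) i 0 * h i 0 + w i))).
    apply: ler_sum => i _; rewrite dotZ; have [_ _ Yi] := YP i.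
    have co0 : 0 <= ka i * h i 0 + ta i by rewrite addr_ge0 // mulr_ge0.
    apply: le_trans (ler_wpM2l co0 Yi) _.
    by have := ler_wpM2r (h0 i) (kath i); have := tath i; lra.
  rewrite big_split lerD2r -dotE.
  have -> : dot (Q^T *m u) h = dot u (Q *m h) by rewrite /dot trmx_mul trmxK mulmxA.
  rewrite !dotE; apply: ler_sum => k _; rewrite [leRHS]mulrC ler_wpM2l ?Uh.2 //.
  by rewrite mxE.
have cx0 : 0 <= dot c x by apply: dot_ge0 => //; exact: X0.
(* Here 48 = 3 * 4 * 4: as z1 <= z1 z2, the cost z1 c x + z1 s + 2 z1 z2 s is at most 3 z1 z2 (c x +
   s). *)
have -> : 48 * log_ratio R n * log_ratio R L = 3 * (z1 * z2) by rewrite /z1 /z2; ring.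
have z12 : z1 <= z1 * z2 by rewrite ler_peMr.
have := ler_wpM2r cx0 z12; have := ler_wpM2r s0 z12; have := ler_wpM2l z10 y2d.
have := mulr_ge0 (mulr_ge0 z10 (le_trans ler01 z21)) cx0.
lra.
Qed.

(** * Comparison of the optimal values *)

(** A feasible affine policy prescribes a feasible recourse in every scenario, so its cost bounds
    the optimal recourse cost. *)
Lemma zAR_le_zAFF (R : realType) (m n n' : nat) (A : 'M[R]_(m, n')) (B : 'M[R]_(m, n))
    (c : 'cV[R]_n') (d : 'cV[R]_n) (X : set 'cV[R]_n') (U : set 'cV[R]_m) :
  (zAR A B c d X U <= zAFF A B c d X U)%E.
Proof.
apply: le_ereal_inf_tmp => _ [p [Xp Up] <-].
apply: (@le_trans _ _ ((dot c (policy_x p))%:E +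
    ereal_sup [set second_stage A B d (policy_x p) h | h in U])%E).
  by apply: ereal_inf_lbound; exists (policy_x p).
apply: leeD2l; apply: ge_ereal_sup => _ [h Uh <-].
apply: (@le_trans _ _ (dot d (policy_y p h))%:E).
  by apply: ereal_inf_lbound; exists (policy_y p h) => //; exact: Up.
by apply: ereal_sup_ubound; exists h.
Qed.

Theorem theorem3 (R : realType) :
  exists (C : R) (N : nat), 0 < C /\
  forall (m n n' L : nat)
    (A : 'M[R]_(m, n')) (B : 'M[R]_(m, n))
    (c : 'cV[R]_n') (d : 'cV[R]_n) (X : set 'cV[R]_n')
    (Q : 'M[R]_(L, m)) (r : 'cV[R]_L),
  mxle 0 B -> mxle 0 c -> mxle 0 d ->
  polyhedral_cone X -> X `<=` [set x | mxle 0 x] ->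
  mxle 0 Q -> mxle 0 r ->
  (forall i : 'I_m, max_coord (dual_set B d) i \is a fin_num) ->
  (forall i : 'I_m, max_coord (packing_set Q r) i \is a fin_num) ->
  (N <= n)%N -> (N <= L)%N ->
  (zAR A B c d X (packing_set Q r) <= zAFF A B c d X (packing_set Q r))%E /\
  (zAFF A B c d X (packing_set Q r) <=
     (C * log_ratio R n * log_ratio R L)%:E
       * zAR A B c d X (packing_set Q r))%E.
Proof.
exists 48, 16%N; split=> // m n n' L A B c d X Q r B0 c0 d0 coneX X0 Q0 r0 thfin gafin n16 L16.
split; first exact: zAR_le_zAFF.
set K := 48 * _ * _.
have lr0 k : (16 <= k)%N -> 0 < log_ratio R k by move=> /(log_ratio_ge1 R); lra.
have K0 : 0 < K by rewrite pmulr_lgt0 ?lr0 // pmulr_lgt0 ?lr0.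
(* Dividing by [K] moves it off the infimum, so that each first stage can be treated separately. *)
rewrite -lee_pdivrMl //; apply: le_ereal_inf_tmp => _ [x Xx <-]; rewrite lee_pdivrMl //.
set U := packing_set Q r; set S := ereal_sup _.
have US h : U h -> (second_stage A B d x h <= S)%E.
  by move=> Uh; apply: ereal_sup_ubound; exists h.
have S0 : (0 <= S)%E.
  apply: le_trans (US 0 (packing_set0 Q r0)); apply: le_ereal_inf_tmp => _ [y [y0 _] <-].
  by rewrite lee_fin dot_ge0.
(* An infinite [S] makes the bound trivial, and [S0] excludes [-oo]. *)
case: S US S0 => [s||] US S0 //; last first.
  by rewrite addey // gt0_muley ?lte_fin // leey.
rewrite lee_fin in S0.
have [p [pfeas pcost]] := affine_policy_of_bound n16 L16 B0 c0 d0 coneX X0 Q0 r0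
  thfin gafin Xx S0 US.
apply: (@le_trans _ _ (affine_cost c d U p)).
  by apply: ereal_inf_lbound; exists p.
rewrite /affine_cost addeC -leeBrDr //; apply: ge_ereal_sup => _ [h Uh <-].
by rewrite lee_fin lerBrDl; exact: pcost.
Qed.
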